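(* For every integer $n\geq 3$ with $n\neq 4$, $\kappa^3(BH_n)=\kappa^4(BH_n)\leq 12n-24$.
   Context: The $n$-dimensional balanced hypercube $BH_n$ ($n\ge 1$) is the simple undirected graph whose vertices are the $4^n$ tuples $(a_0,a_1,\ldots,a_{n-1})$ with each $a_j\in\{0,1,2,3\}$. The vertex $(a_0,\ldots,a_{n-1})$ is adjacent to exactly the following $2n$ vertices: (1) $(a_0\pm 1 \bmod 4,\,a_1,\ldots,a_{n-1})$; (2) for each $i$ with $1\le i\le n-1$, the two vertices $(a_0\pm 1\bmod 4,\,a_1,\ldots,a_{i-1},\,a_i+(-1)^{a_0}\bmod 4,\,a_{i+1},\ldots,a_{n-1})$. For a graph $G$ and an integer $h\ge 0$, an $h$-vertex cut of $G$ is a set $F\subset V(G)$ such that $G-F$ is disconnected and every component of $G-F$ has minimum degree at least $h$. The (restricted) $h$-connectivity $\kappa^h(G)$ is the minimum cardinality of an $h$-vertex cut of $G$, if an $h$-vertex cut exists. A statement giving a value of, or an upper bound on, $\kappa^h(G)$ includes the assertion that an $h$-vertex cut exists. *)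

(* Defs.v *)
From mathcomp Require Import all_boot all_algebra.
Set Implicit Arguments.
Unset Strict Implicit.
Unset Printing Implicit Defensive.
Import GRing.Theory.

Record sgraph := SGraph {
  vertex :> finType;
  adj : rel vertex;
  adj_sym : symmetric adj;
  adj_irrefl : irreflexive adj }.

(* The subgraph of G induced by A is represented on the same carrier; vertices
   outside A are isolated and have to be excluded explicitly. *)
Definition induced_rel (G : sgraph) (A : {set G}) : rel G :=
  [rel x y | [&& x \in A, y \in A & adj x y]].

Definition disconnected (G : sgraph) (A : {set G}) : bool :=
  [exists x in A, exists y in A, ~~ connect (induced_rel A) x y].

Definition components (G : sgraph) (A : {set G}) : {set {set G}} :=
  [set [set y in A | connect (induced_rel A) x y] | x in A].

Definition min_degree_ge (G : sgraph) (h : nat) (C : {set G}) : bool :=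
  [forall x in C, h <= #|[set y in C | adj x y]|].

(* G - F is the subgraph induced by the complement of F. *)
Definition vertex_cut (G : sgraph) (h : nat) (F : {set G}) : bool :=
  disconnected (~: F) && [forall C in components (~: F), min_degree_ge h C].

(* The h-connectivity is a partial function of G: this relation holds for at
   most one k, and for none when G has no h-vertex cut. *)
Definition h_connectivity (G : sgraph) (h k : nat) : Prop :=
  (exists2 F : {set G}, vertex_cut h F & #|F| = k) /\
  (forall F : {set G}, vertex_cut h F -> k <= #|F|).

Local Open Scope ring_scope.

Definition BH_vertex (n : nat) : finType := {ffun 'I_n -> 'Z_4}.

(* For i = ord0 only the coordinate a_0 changes; the other values of i give the
   neighbours in which a_i changes as well. *)
Definition BH_neighbour (m : nat) (a : BH_vertex m.+1) (s : bool) (i : 'I_m.+1) :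
    BH_vertex m.+1 :=
  [ffun j => if j == ord0 then a j + (-1) ^+ s
             else if j == i then a j + (-1) ^+ (nat_of_ord (a ord0))
             else a j].

(* The dimension is meant to be positive; n = 0 gives a single vertex. *)
Definition BH_adj (n : nat) : rel (BH_vertex n) :=
  match n return rel (BH_vertex n) with
  | 0 => fun _ _ => false
  | m.+1 => fun a b => [exists s, exists i, b == BH_neighbour a s i]
  end.

Lemma BH_adj_sym n : symmetric (@BH_adj n).
Proof.
case: n => [//|m].
have Z4 (x : 'Z_4) (s : bool) :
    (-1) ^+ nat_of_ord (x + (-1) ^+ s) = - (-1) ^+ (nat_of_ord x) :> 'Z_4.
  by case: s; case: x => [[|[|[|[|?]]]] ?] //; apply/val_inj.
suff sub (a b : BH_vertex m.+1) : @BH_adj m.+1 a b -> @BH_adj m.+1 b a.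
  by move=> a b; apply/idP/idP; apply: sub.
move=> /existsP[s /existsP[i /eqP->]]; apply/existsP; exists (~~ s).
apply/existsP; exists i; apply/eqP/ffunP => j; rewrite !ffunE eqxx Z4.
by case: eqP => _; [case: s; rewrite /= ?addrNK ?addrK
                   | case: eqP => _; rewrite ?addrK].
Qed.

Lemma BH_adj_irrefl n : irreflexive (@BH_adj n).
Proof.
case: n => [//|m] a; apply/existsP => -[s /existsP[i /eqP/ffunP/(_ ord0)]].
rewrite ffunE eqxx -[LHS]addr0 => /addrI; by case: s.
Qed.

Definition BH (n : nat) : sgraph := SGraph (@BH_adj_sym n) (@BH_adj_irrefl n).

(* Main.v *)
Require Import Defs.
From mathcomp Require Import all_boot all_algebra ring zify.
Set Implicit Arguments.
Unset Strict Implicit.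
Unset Printing Implicit Defensive.
Import GRing.Theory.

(** Two facts about [BH n] give the theorem.

    Twins.  The vertices [a] and [a + 2 e_0] have the same neighbours.  In a
    minimum 3-cut [F], a vertex whose twin survives could be returned to the
    graph: it joins the component of its twin and sees as many survivors, so a
    smaller 3-cut would result.  Hence [F] is a union of twin pairs, the
    surviving neighbours of any vertex come in twin pairs too, and a degree that
    is at least 3 is at least 4 ([h_connectivity_twins]).

    A hexagon.  Identifying twins turns [BH n] into an [n]-regular bipartite
    graph of girth 6.  Removing the neighbourhood of one of its hexagons
    separates that hexagon from the rest, and costs at most [6 (n - 2)] twin
    pairs, that is [12 n - 24] vertices.  For this to be a 4-cut, each survivor
    needs two surviving directions.  The coordinates given by [chart] make this
    a computation with sums of unit vectors of [Z_4 ^ n]: there the two colour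
    classes look alike, and the neighbour of [v] in direction [l] is
    [s - e_l - v], where [s] is the indicator of a set [T] of three indices.
    The hexagon consists of the vectors [e_i] with [i] in [T].  Outside it and
    its neighbourhood, the only vectors with two or more directions leading to
    that neighbourhood are the [e_k] with [k] outside [T], which have exactly
    three ([two_flips_off_rim]).  So [n - 3] directions remain for them, which
    is enough when [5 <= n]; there are none of them when [n = 3]; when [n = 4]
    a single direction remains and the hexagon does not give a 4-cut. *)

(** * Vertex cuts and twins *)

Lemma induced_rel_sym (G : sgraph) (A : {set G}) : symmetric (induced_rel A).
Proof. by move=> x y; apply/and3P/and3P => -[xA yA]; rewrite adj_sym. Qed.

(** The component of a survivor [x] contains all surviving neighbours of [x], so
    the degrees inside the components are the degrees in the complement of the
    cut. *)
Lemma vertex_cutP (G : sgraph) (h : nat) (F : {set G}) :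
  reflect (disconnected (~: F) /\
           forall x, x \notin F -> h <= #|[set y in ~: F | adj x y]|)
          (vertex_cut h F).
Proof.
have compN (z x : G) : x \notin F -> connect (induced_rel (~: F)) z x ->
    [set y in [set y in ~: F | connect (induced_rel (~: F)) z y] | adj x y] =
    [set y in ~: F | adj x y].
  move=> xF zx; apply/setP => y; rewrite !inE.
  case: (boolP (y \in F)) => //= yF.
  case: (boolP (adj x y)) => xy; last by rewrite andbF.
  by rewrite (connect_trans zx) //; apply: connect1; apply/and3P; rewrite !inE.
apply: (iffP andP) => -[disc deg]; split=> //.
  move=> x xF; rewrite -(compN x x) //.
  have /imsetP cx : exists2 z, z \in ~: F &
      [set y in ~: F | connect (induced_rel (~: F)) x y] =
      [set y in ~: F | connect (induced_rel (~: F)) z y].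
    by exists x; rewrite ?inE.
  move/forall_inP: deg => /(_ _ cx)/forall_inP/(_ x); apply.
  by rewrite !inE xF /=.
apply/forall_inP => C /imsetP[z zF ->]; apply/forall_inP => x.
by rewrite !inE => /andP[xF zx]; rewrite compN //; apply: deg.
Qed.

Lemma vertex_cut_leq (G : sgraph) (h h' : nat) (F : {set G}) :
  h <= h' -> vertex_cut h' F -> vertex_cut h F.
Proof.
move=> hh /vertex_cutP[disc deg]; apply/vertex_cutP; split=> // x xF.
exact: leq_trans hh (deg x xF).
Qed.

Lemma h_connectivity_exists (G : sgraph) (h : nat) (F : {set G}) :
  vertex_cut h F -> exists2 k, h_connectivity G h k & k <= #|F|.
Proof.
move=> cutF; case: (arg_minnP (fun F' : {set G} => #|F'|) cutF) => M cutM minM.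
by exists #|M|; [split; [exists M | exact: minM] | exact: minM].
Qed.

Lemma even_card_involution (T : finType) (t : T -> T) (A : {set T}) :
  involutive t -> (forall x, t x != x) -> (forall x, x \in A -> t x \in A) ->
  ~~ odd #|A|.
Proof.
move=> tK tfix tA.
have order2 x : order t x = 2.
  rewrite (@order_cycle _ t [:: x; t x]) ?inE ?eqxx //=.
    by rewrite tK !eqxx.
  by rewrite inE eq_sym tfix.
have clA : fclosed t A.
  move=> x y /eqP <-; apply/idP/idP; first exact: tA.
  by move=> /tA; rewrite tK.
have subA : A \subset order_set t 2 by apply/subsetP => x _; rewrite inE order2.
by rewrite -(fcard_order_set (inv_inj tK) subA clA) muln2 odd_double.
Qed.

(** Sending [x] to its twin [x'] retracts the enlarged induced subgraph onto the
    original one, so adding [x] merges no components. *)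
Lemma disconnected_twin (G : sgraph) (A : {set G}) (x x' : G) :
  x' \in A -> adj x =1 adj x' -> disconnected A -> disconnected (x |: A).
Proof.
move=> x'A twin /exists_inP[y yA /exists_inP[z zA nyz]].
have [xA | xA] := boolP (x \in A).
  rewrite (setUidPr _) ?sub1set //.
  by apply/exists_inP; exists y => //; apply/exists_inP; exists z.
apply/exists_inP; exists y; first by rewrite inE yA orbT.
apply/exists_inP; exists z; first by rewrite inE zA orbT.
apply: contra nyz => yz; pose r v := if v == x then x' else v.
have rA v : v \in A -> r v = v.
  by rewrite /r; case: eqP => // ->; rewrite (negPf xA).
have radj u v : adj (r u) v = adj u v.
  by rewrite /r; case: eqP => // ->; rewrite twin.
have rmem v : v \in x |: A -> r v \in A by rewrite !inE /r; case: eqP.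
have hom : {homo r : u v / induced_rel (x |: A) u v >-> induced_rel A u v}.
  move=> u v /and3P[uA vA uv]; apply/and3P; split; try exact: rmem.
  by rewrite radj adj_sym radj adj_sym.
rewrite -(rA y) // -(rA z) //; case/connectP: yz => p yp ->.
by apply/connectP; exists [seq r v | v <- p]; rewrite ?last_map ?(homo_path hom).
Qed.

(** A minimum cut for odd [h] is closed under the twin involution, which then
    pairs up the surviving neighbours of each vertex and makes degrees even. *)
Lemma h_connectivity_twins (G : sgraph) (t : G -> G) (h k : nat) :
  involutive t -> (forall x, t x != x) -> (forall x, adj (t x) =1 adj x) ->
  odd h -> h_connectivity G h k -> h_connectivity G h.+1 k.
Proof.
move=> tK tfix tadj hodd [[F cutF cardF] minF].
have tF x : x \in F -> t x \in F.
  move=> xF; apply: contraTT isT => txF.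
  have /vertex_cutP[disc deg] := cutF.
  have compl : ~: (F :\ x) = x |: ~: F.
    by apply/setP => y; rewrite !inE negb_and negbK.
  have cut : vertex_cut h (F :\ x).
    apply/vertex_cutP; split.
      rewrite compl; apply: (@disconnected_twin _ _ _ (t x)) => //.
        by rewrite inE.
      by move=> y; rewrite tadj.
    move=> y yF.
    (* y has the neighbours of a vertex z that already survives F. *)
    have [z zF adjz] : exists2 z, z \notin F & adj z =1 adj y.
      move: yF; rewrite !inE negb_and negbK => /orP[/eqP-> | yF].
        by exists (t x).
      by exists y.
    apply: leq_trans (deg z zF) _; apply/subset_leq_card/subsetP => w.
    by rewrite !inE adjz negb_and => /andP[-> ->]; rewrite orbT.
  by move: (minF _ cut); rewrite -cardF (cardsD1 x F) xF ltnn.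
split; last by move=> F' /(vertex_cut_leq (leqnSn h)); apply: minF.
exists F => //; have /vertex_cutP[disc deg] := cutF.
apply/vertex_cutP; split=> // x xF; rewrite ltn_neqAle deg // andbT.
apply: contraL hodd => /eqP->; apply: (even_card_involution tK tfix) => y.
rewrite !inE => /andP[yF xy]; rewrite (contra (@tF _)) ?tK //.
by rewrite adj_sym tadj adj_sym.
Qed.

(** * The hexagon in coordinates *)

Local Open Scope ring_scope.

Section Hexagon.

Variables (I : finType) (T : {set I}).
Hypothesis cardT : #|T| = 3%N.

Notation vect := {ffun I -> 'Z_4}.

Definition unit_vect (i : I) : vect := [ffun j => (j == i)%:R].
Definition apex : vect := [ffun j => (j \in T)%:R].
(** The neighbour of [v] in direction [l], whatever the colour of [v]; an
    involution in [v]. *)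
Definition flip (v : vect) (l : I) : vect := apex - unit_vect l - v.
Definition on_hexagon (v : vect) := [exists i in T, v == unit_vect i].
(** The closed neighbourhood of the hexagon: by [flip_hexagon] each vector of
    the hexagon is a flip of another one. *)
Definition near_hexagon (v : vect) :=
  [exists i in T, exists l, v == flip (unit_vect i) l].
Definition rim (v : vect) := near_hexagon v && ~~ on_hexagon v.

(** With [T] consisting of [i], [l] and [k], the vector [s - e_l - e_i] is
    [e_k]. *)
Lemma flip_hexagon i l : i \in T -> l \in T -> l != i ->
  on_hexagon (flip (unit_vect i) l).
Proof.
move=> iT lT li; have cT' : #|T :\ i :\ l| == 1%N.
  by move: cardT; rewrite (cardsD1 i) iT (cardsD1 l) !inE li lT => /eqP.
have /cards1P[k Ek] := cT'.
have memT j : (j \in T) = [|| j == k, j == l | j == i].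
  move/setP/(_ j): Ek; rewrite !inE => <-.
  by case: (j =P l) => [->|_] //=; case: (j =P i) => [->|_] //=; rewrite orbF.
apply/exists_inP; exists k; first by rewrite memT eqxx.
have : k \in T :\ i :\ l by rewrite Ek inE.
rewrite !inE => /and3P[kl ki _].
apply/eqP/ffunP => j; rewrite !ffunE memT.
have [->|jk] := eqVneq j k; first by rewrite (negPf kl) (negPf ki) /= !subr0.
have [->|jl] := eqVneq j l; first by rewrite (negPf li) subrr subr0.
by case: (j == i); rewrite ?subr0 ?subrr.
Qed.

Lemma flip_near v l :
  near_hexagon (flip v l) =
  [exists i in T, exists k, v + unit_vect l == unit_vect i + unit_vect k].
Proof.
apply: eq_existsb => i; congr andb; apply: eq_existsb => k.
rewrite /flip -!addrA (inj_eq (addrI apex)) -!opprD (inj_eq oppr_inj).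
by rewrite addrC [X in _ == X]addrC.
Qed.

(** Two representations [v + e_l = e_i + e_k] and [v + e_m = e_i' + e_k'] give
    [e_i + e_k + e_m = e_i' + e_k' + e_l].  A sum of three unit vectors has
    entries at most 3 and so determines its terms even modulo 4; as [l != m],
    the index [l] is [i] or [k], and it cancels from the first representation. *)
Lemma two_near_flips v l m : l != m ->
  near_hexagon (flip v l) -> near_hexagon (flip v m) ->
  exists k, v = unit_vect k.
Proof.
rewrite !flip_near => lm /exists_inP[i iT /existsP[k /eqP vl]].
move=> /exists_inP[i' i'T /existsP[k' /eqP vm]].
have : (l == i) || (l == k).
  have /ffunP/(_ l) : unit_vect i + unit_vect k + unit_vect m =
                      unit_vect i' + unit_vect k' + unit_vect l.
    by rewrite -vl -vm addrAC.
  rewrite !ffunE eqxx (negPf lm) => /eqP.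
  by case: (l == i); case: (l == k); case: (l == i'); case: (l == k').
case/orP => /eqP El; rewrite -El in vl.
  by exists k; apply: (addIr (unit_vect l)); rewrite vl addrC.
by exists i; apply: (addIr (unit_vect l)).
Qed.

(** If [e_k + e_l] were [e_i + e_j] with [i] in [T], then [i] would be [k] or
    [l]. *)
Lemma flip_off_hexagon k l : k \notin T -> l \notin T ->
  ~~ near_hexagon (flip (unit_vect k) l).
Proof.
rewrite flip_near => kT lT; apply/negP => /exists_inP[i iT /existsP[j /eqP]].
move/ffunP/(_ i).
have neq x : x \notin T -> (i == x) = false.
  by move=> xT; apply: contraNF xT => /eqP <-.
by rewrite !ffunE eqxx (neq k) // (neq l) // => /eqP; case: (i == j).
Qed.

(** On the hexagon the good directions are the two other indices of [T].  Off
    its closed neighbourhood, either at most one direction is bad, or the vector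
    is some [e_k] with [k] outside [T] and every direction outside [T] is good;
    the bound on [#|I|] provides two of these. *)
Lemma two_flips_off_rim v : (#|I| = 3 \/ 5 <= #|I|)%N -> ~~ rim v ->
  (2 <= #|[set l | ~~ rim (flip v l)]|)%N.
Proof.
move=> cardI; rewrite negb_and negbK orbC.
have [/exists_inP[i iT /eqP-> _] | nhex /= nnear] := boolP (on_hexagon v).
  have card2 : #|T :\ i| = 2%N by move: cardT; rewrite (cardsD1 i) iT => -[].
  rewrite -card2; apply/subset_leq_card/subsetP => l; rewrite !inE => /andP[li lT].
  by rewrite /rim flip_hexagon ?andbF.
have cardC : (#|[set l | rim (flip v l)]| + #|[set l | ~~ rim (flip v l)]| = #|I|)%N.
  rewrite -cardsT -(cardsID [set l | rim (flip v l)] setT).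
  by congr addn; apply: eq_card => l; rewrite !inE ?andbT.
case: (ltnP 1 #|[set l | rim (flip v l)]|) => [|le1]; last by lia.
move=> /card_gt1P[l [m []]]; rewrite !inE => /andP[nl _] /andP[nm _] lm.
have [k Ev] := two_near_flips lm nl nm.
have kT : k \notin T.
  by apply: contra nhex => kT; apply/exists_inP; exists k; rewrite ?Ev.
have cardTC : (#|T| + #|~: T| = #|I|)%N by rewrite cardsC.
have TC : (0 < #|~: T|)%N by apply/card_gt0P; exists k; rewrite inE.
apply: (@leq_trans #|~: T|); first by lia.
apply/subset_leq_card/subsetP => l'; rewrite !inE Ev => l'T.
by rewrite negb_and flip_off_hexagon.
Qed.

(** Each of the three vectors [e_i] has two of its [#|I|] directions inside the
    hexagon. *)
Lemma card_rim : (#|[set v | rim v]| <= 3 * (#|I| - 2))%N.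
Proof.
pose P := [set p : I * I | (p.1 \in T) && (p.2 \notin T :\ p.1)].
have cardP : #|P| = (3 * (#|I| - 2))%N.
  rewrite -cardT -sum_nat_const.
  rewrite -sum1_card (eq_bigl (fun p => (p.1 \in T) && (p.2 \notin T :\ p.1))).
    rewrite -(pair_big_dep (mem T) (fun i j => j \notin T :\ i) (fun _ _ => 1%N)) /=.
    apply: eq_bigr => i iT; rewrite sum1_card.
    have := cardsC (T :\ i); have := cardsD1 i T; rewrite iT cardT.
    have -> : #|~: (T :\ i)| = #|[pred j | j \notin T :\ i]|.
      by apply: eq_card => j; rewrite !inE.
    move=> E1 E2; have -> : #|I| = (2 + #|[pred j | j \notin T :\ i]|)%N.
      by rewrite -E2; move: E1; lia.
    by rewrite addKn; apply: eq_card.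
  by move=> p; rewrite inE.
rewrite -cardP.
apply: leq_trans (leq_imset_card (fun p => flip (unit_vect p.1) p.2) _).
apply/subset_leq_card/subsetP => v; rewrite inE => /andP[].
move=> /exists_inP[i iT /existsP[l /eqP Ev]] nhex.
apply/imsetP; exists (i, l) => //; rewrite inE iT /= !inE negb_and negbK.
by have [//|li /=] := eqVneq l i; apply: contra nhex => lT; rewrite Ev flip_hexagon.
Qed.

End Hexagon.

(** * The balanced hypercube *)

Section BH.
Variable m : nat.
Notation I := 'I_m.+3.
Notation V := (BH_vertex m.+3).

Definition triple : {set I} := [set i : I | (i < 3)%N].

Lemma card_triple : #|triple| = 3%N.
Proof.
by rewrite -sum1dep_card big_mkcond !big_ord_recl big1.
Qed.

(** Negating the vertices with odd [a_0] exchanges the roles of [+ e_l] and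
    [- e_l]; the shift by the indicator of the triple makes the hexagon invariant
    under this exchange, so that both colours get the same description. *)
Definition mirror (a : V) (j : I) : 'Z_4 :=
  if odd (a ord0) then (j \in triple)%:R - a j else a j.

(** The free coordinate at 0, where only the parity of [a_0] matters up to
    twins, makes all coordinates sum to 1.  Then direction 0, which changes
    [a_0] only, becomes a unit vector like any other direction. *)
Definition chart (a : V) : {ffun I -> 'Z_4} :=
  [ffun j => if j == ord0 then 1 - \sum_(i | i != ord0) mirror a i
             else mirror a j].

Lemma chart_inj (a b : V) : a ord0 = b ord0 -> chart a = chart b -> a = b.
Proof.
move=> ab0 /ffunP cab; apply/ffunP => j.
have [-> //|j0] := eqVneq j ord0.
have := cab j; rewrite !ffunE (negPf j0) /mirror ab0.
by case: odd => // /addrI/oppr_inj.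
Qed.

Lemma odd_neighbour (a : V) s i : odd (BH_neighbour a s i ord0) = ~~ odd (a ord0).
Proof. by rewrite ffunE eqxx; case: (a ord0) => -[|[|[|[|?]]]] //= ?; case: s. Qed.

(** Away from index 0 this is immediate from the definitions; at index 0 it
    follows because a flip keeps the coordinate sum: [3 - 1 - 1 = 1]. *)
Lemma chart_neighbour (a : V) s i :
  chart (BH_neighbour a s i) = flip triple (chart a) i.
Proof.
have cN j : j != ord0 -> mirror (BH_neighbour a s i) j =
    (j \in triple)%:R - (j == i)%:R - mirror a j.
  move=> j0; rewrite /mirror odd_neighbour ffunE (negPf j0) -signr_odd.
  case: odd => /=; case: (j == i); rewrite ?subr0 ?opprB ?addrA ?expr1 ?expr0.
  - by rewrite addrAC [X in _ = X + _]addrAC subrr add0r addrC.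
  - by rewrite addrAC subrr add0r.
  - by rewrite opprD addrA addrAC.
  - by [].
apply/ffunP => j; rewrite !ffunE.
have [->|j0] := eqVneq j ord0; last exact: cN.
rewrite (eq_bigr _ cN) !sumrB.
have sumT : \sum_(k | k != ord0) (k \in triple)%:R = 2 :> 'Z_4.
  have := card_triple; rewrite -sum1_card big_mkcond (bigD1 ord0) //= inE /= => -[E].
  rewrite -E natr_sum; apply: eq_bigr => k _.
  by case: (k \in triple).
have sumi : \sum_(k | k != ord0) (k == i)%:R = 1 - (ord0 == i)%:R :> 'Z_4.
  have : \sum_k (k == i)%:R = 1 :> 'Z_4.
    by rewrite (bigD1 i) //= eqxx big1 ?addr0 // => k /negPf->.
  by rewrite (bigD1 ord0) //= addrC => E; apply/eqP; rewrite eq_sym subr_eq E.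
rewrite sumT sumi inE /= !opprB.
ring.
Qed.

Lemma neighbour_inj (a : V) : injective (fun p : bool * I => BH_neighbour a p.1 p.2).
Proof.
move=> [s i] [s' i'] /= E; congr pair.
  move/ffunP/(_ ord0): E; rewrite !ffunE eqxx => /addrI/eqP.
  by case: s; case: s'.
have := congr1 chart E; rewrite !chart_neighbour /flip.
move/addIr/addrI/oppr_inj/ffunP/(_ i); rewrite !ffunE eqxx.
by case: (i =P i') => // _ /eqP.
Qed.

(** The neighbourhood of the 12 vertices that lie over the hexagon. *)
Definition hexagon_cut : {set BH m.+3} := [set a | rim triple (chart a)].

(** Each direction accounts for two neighbours, which are twins of each other. *)
Lemma neighbours_off_cut (a : BH m.+3) :
  (m = 0 \/ 2 <= m)%N -> a \notin hexagon_cut ->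
  (4 <= #|[set b in ~: hexagon_cut | adj a b]|)%N.
Proof.
rewrite inE => cm aF; pose good := [set i | ~~ rim triple (flip triple (chart a) i)].
have good2 : (2 <= #|good|)%N.
  by apply: two_flips_off_rim aF; rewrite ?card_triple // card_ord; lia.
apply: (@leq_trans #|setX [set: bool] good|).
  by rewrite cardsX cardsT card_bool; lia.
rewrite -(card_imset _ (@neighbour_inj a)); apply/subset_leq_card/subsetP => b.
case/imsetP => -[s i]; rewrite !inE /= => gi ->; rewrite chart_neighbour gi /=.
by apply/existsP; exists s; apply/existsP; exists i.
Qed.

(** Neighbours of hexagon vertices are on the hexagon or in the cut. *)
Lemma disconnected_hexagon_cut : disconnected (~: hexagon_cut).
Proof.
pose x : V := [ffun=> 0]; pose y : V := [ffun j => if val j == 1%N then 2 else 0].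
have hx : on_hexagon triple (chart x).
  (* chart x is the unit vector at 0. *)
  apply/exists_inP; exists ord0; rewrite ?inE //; apply/eqP/ffunP => j.
  rewrite !ffunE /mirror /= ?ffunE /= big1 ?subr0 => [|i _]; last by rewrite /mirror !ffunE.
  by case: (j == ord0).
(* At an index of the triple, the vectors near the hexagon have entry 1, 0 or
   -1, whereas chart y has entry 2 at index 1. *)
have hy : ~~ near_hexagon triple (chart y).
  apply/negP => /exists_inP[i _ /existsP[l /eqP/ffunP/(_ (inord 1))]].
  rewrite !ffunE /mirror !ffunE /= -val_eqE /= inordK //= inE inordK //= => /eqP.
  by case: (_ == i); case: (_ == l).
have closed_hex : closed (induced_rel (~: hexagon_cut))
    [pred a : BH m.+3 | on_hexagon triple (chart a)].
  apply: intro_closed; first exact: sym_connect_sym (induced_rel_sym _).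
  move=> a b /and3P[_ bF /existsP[s /existsP[l /eqP Eb]]] ha.
  move: bF; rewrite inE inE negb_and negbK Eb inE chart_neighbour.
  case/orP => // /negP[]; have /exists_inP[i iT /eqP->] := ha.
  by apply/exists_inP; exists i => //; apply/existsP; exists l.
apply/exists_inP; exists x; first by rewrite inE inE negb_and negbK hx orbT.
apply/exists_inP; exists y; first by rewrite inE inE negb_and hy.
apply/negP => /(closed_connect closed_hex); rewrite !inE hx => /esym.
move=> /exists_inP[i iT /eqP/ffunP/(_ (inord 1))].
by rewrite !ffunE /mirror !ffunE /= -val_eqE /= inordK //= => /eqP; case: (_ == i).
Qed.

(** Over each vector of the rim there is at most one vertex for each of the four
    values of [a_0]. *)
Lemma card_hexagon_cut : (#|hexagon_cut| <= 12 * m.+3 - 24)%N.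
Proof.
pose f (a : V) : 'Z_4 * {ffun I -> 'Z_4} := (a ord0, chart a).
have f_inj : injective f by move=> a b [ab0]; apply: chart_inj.
rewrite -(card_imset _ f_inj).
apply: (@leq_trans #|setX [set: 'Z_4] [set v | rim triple v]|).
  apply/subset_leq_card/subsetP => p /imsetP[a].
  by rewrite inE => ra ->; rewrite !inE.
rewrite cardsX cardsT (card_ord 4).
by have := card_rim card_triple; rewrite card_ord; lia.
Qed.

Definition twin (a : BH m.+3) : BH m.+3 :=
  [ffun j : I => if j == ord0 then (a : V) j + 2 else (a : V) j].

Lemma twinK : involutive twin.
Proof.
move=> a; apply/ffunP => j; rewrite !ffunE; case: eqP => // _.
by rewrite -addrA [2 + 2](_ : _ = 0) ?addr0 //; apply/eqP.
Qed.

Lemma twin_neq a : twin a != a.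
Proof.
apply/eqP => /ffunP/(_ ord0); rewrite ffunE eqxx -[RHS]addr0 => /addrI/eqP.
by [].
Qed.

Lemma twin_neighbour (a : V) s i : BH_neighbour (twin a) s i = BH_neighbour a (~~ s) i.
Proof.
apply/ffunP => j; rewrite !ffunE; case: (j == ord0).
  by rewrite -addrA; congr (_ + _); apply/eqP; case: s.
case: (j == i) => //; congr (_ + _); apply/eqP.
by case: (a ord0) => -[|[|[|[|?]]]] //.
Qed.

Lemma adj_twin a : adj (twin a) =1 adj a.
Proof.
move=> b; apply/existsP/existsP => -[s /existsP[i /eqP->]].
  by exists (~~ s); apply/existsP; exists i; rewrite twin_neighbour.
by exists (~~ s); apply/existsP; exists i; rewrite twin_neighbour negbK.
Qed.

End BH.

Local Close Scope ring_scope.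

Theorem lemma12 (n : nat) (hn : 3 <= n) (hn4 : n <> 4) :
  exists k : nat, [/\ h_connectivity (BH n) 3 k,
                      h_connectivity (BH n) 4 k
                    & k <= 12 * n - 24].
Proof.
case: n hn hn4 => [|[|[|m]]] // _ hn4.
have cut4 : vertex_cut 4 (hexagon_cut m).
  apply/vertex_cutP; split; first exact: disconnected_hexagon_cut.
  by move=> a; apply: neighbours_off_cut; lia.
have [k con3 kF] := h_connectivity_exists (vertex_cut_leq (leqnSn 3) cut4).
exists k; split=> //; last exact: leq_trans kF (card_hexagon_cut m).
exact: h_connectivity_twins (@twinK m) (@twin_neq m) (@adj_twin m) _ con3.
Qed.
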